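(* For each positive integer $k$, there exists an oriented graph $G$ with $\delta^0(G) = \bar{\delta}^0(G) = k$ that contains neither an antipath of length $2k$ nor an anticycle of length $2k$.
   Context: An oriented graph is a loopless directed graph without cycles of length $2$ (that is, for any two distinct vertices $u,v$, at most one of $uv$ and $vu$ is an edge). The minimum semidegree $\delta^0(G)$ of a digraph $G$ is the minimum value amongst the in-degrees and out-degrees of all its vertices. The minimum pseudo-semidegree $\bar{\delta}^0(G)$ of a digraph $G$ with at least one edge is the minimum value amongst all non-zero in-degrees and non-zero out-degrees of its vertices; if $G$ has no edges, then $\bar{\delta}^0(G)=0$. An antipath is an oriented path (an orientation of a path with distinct vertices) in which each vertex has in-degree $0$ or out-degree $0$ within the path. An anticycle is an oriented cycle (necessarily of even length) in which each vertex has in-degree $0$ or out-degree $0$ within the cycle. The length of a path or cycle is its number of edges. ''Contains'' means as a (not necessarily induced) subgraph. *)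

(* Defs.v *)
From mathcomp Require Import all_boot.

Set Implicit Arguments.
Unset Strict Implicit.
Unset Printing Implicit Defensive.

(* A finite digraph is a relation e on a finType, e u v meaning that uv is an
   edge. *)

Section Digraph.
Variables (V : finType) (e : rel V).

Definition oriented_graph : Prop :=
  irreflexive e /\ forall u v, u != v -> ~~ (e u v && e v u).

Definition outdeg (v : V) : nat := #|[set w | e v w]|.
Definition indeg (v : V) : nat := #|[set u | e u v]|.

Definition degrees : seq nat :=
  [seq outdeg v | v <- enum V] ++ [seq indeg v | v <- enum V].

End Digraph.

(* Convention: the minimum of the empty sequence is 0. *)
Definition seqmin (s : seq nat) : nat := \big[minn/head 0 s]_(d <- s) d.

Definition min_semidegree (V : finType) (e : rel V) : nat :=
  seqmin (degrees e).

(* The filtered sequence is empty exactly when e has no edge, and then the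
   value is 0. *)
Definition min_pseudo_semidegree (V : finType) (e : rel V) : nat :=
  seqmin [seq d <- degrees e | d != 0].

(* Not necessarily induced subgraph containment. *)
Definition contains (V W : finType) (e : rel V) (h : rel W) : Prop :=
  exists f : W -> V, injective f /\ forall x y, h x y -> e (f x) (f y).

(* Orientations of the path 0 - 1 - ... - n, which has n edges. *)
Definition oriented_path (n : nat) (p : rel 'I_n.+1) : Prop :=
  oriented_graph p /\
  forall i j : 'I_n.+1,
    (p i j || p j i) = (i.+1 == j :> nat) || (j.+1 == i :> nat).

(* Orientations of the cycle 0 - 1 - ... - (n-1) - 0, which has n edges; ordS
   is the cyclic successor. The bound excludes n <= 2, where this adjacency
   relation does not describe a cycle (for n = 2 it is a single edge). *)
Definition oriented_cycle (n : nat) (c : rel 'I_n) : Prop :=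
  [/\ 2 < n, oriented_graph c
    & forall i j : 'I_n, (c i j || c j i) = (ordS i == j) || (ordS j == i)].

Definition antidirected (W : finType) (h : rel W) : Prop :=
  forall v, indeg h v = 0 \/ outdeg h v = 0.

Definition contains_antipath (V : finType) (e : rel V) (n : nat) : Prop :=
  exists p : rel 'I_n.+1,
    [/\ oriented_path p, antidirected p & contains e p].

Definition contains_anticycle (V : finType) (e : rel V) (n : nat) : Prop :=
  exists c : rel 'I_n,
    [/\ oriented_cycle c, antidirected c & contains e c].

(* Main.v *)
Require Import Defs.
From mathcomp Require Import all_boot zify.

Set Implicit Arguments.
Unset Strict Implicit.
Unset Printing Implicit Defensive.

(** Start from two copies [S_0], [S_1] of a directed [k]-cycle and two
    independent sets [I_0], [I_1] of size [k - 1], and add all edges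
    [I_b -> S_b] and [S_b -> I_(1-b)]; every in- and out-degree is [k].  Two
    consecutive edges of an antidirected walk have a common source or a common
    sink, so they meet the same [S_b].  No two vertices outside [S_b] are
    consecutive on the walk, so an antipath or anticycle of length [2k], having
    at most [k] vertices in [S_b], must alternate between [S_b] and the
    independent sets.  Hence it has at least [k] vertices outside [S_b], all of
    them sources or all of them sinks, so all in one and the same set of size
    [k - 1].  This requires [k >= 3]; the rotational tournaments on 3 and 5
    vertices settle [k = 1] and [k = 2]. *)

(** * Minimum semidegrees of regular digraphs *)

Lemma seqmin_constant (d : nat) (s : seq nat) :
  s != [::] -> {in s, forall x, x = d} -> seqmin s = d.
Proof.
case: s => // x s _ sd; have xd := sd x (mem_head x s); subst d.
rewrite /seqmin /= big_seq.
by elim/big_ind: _ => [|y z -> ->|y /sd] //; rewrite minnn.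
Qed.

Lemma regular_min_semidegrees (V : finType) (e : rel V) (d : nat) (v0 : V) :
  0 < d -> (forall v, outdeg e v = d /\ indeg e v = d) ->
  min_semidegree e = d /\ min_pseudo_semidegree e = d.
Proof.
move=> d_gt0 reg.
have degd : {in degrees e, forall x, x = d}.
  by move=> x; rewrite mem_cat => /orP[] /mapP[v _ ->]; case: (reg v).
have deg0 : degrees e != [::].
  by rewrite -size_eq0 size_cat size_map -cardE -lt0n addn_gt0; apply/orP; left;
     apply/card_gt0P; exists v0.
have -> : min_pseudo_semidegree e = min_semidegree e.
  rewrite /min_pseudo_semidegree; congr seqmin; apply/all_filterP/allP => x.
  by move/degd ->; rewrite -lt0n.
by split; apply: seqmin_constant.
Qed.

(** * Antipaths and anticycles as alternating walks indexed by [nat] *)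

Definition antiwalk (T : Type) (e : rel T) (b : bool) (g : nat -> T) (n : nat) :=
  forall i, i < n ->
    if odd i (+) b then e (g i.+1) (g i) else e (g i) (g i.+1).

(** Two consecutive edges pointing the same way would give their middle vertex both an in- and an
    out-neighbour. So directions alternate, and the first edge fixes [b]: even positions are the
    sources exactly when [b] is false. *)
Lemma antidirected_antiwalk (W : finType) (h : rel W) (p : nat -> W) (n : nat) :
  antidirected h -> (forall i, i < n -> h (p i) (p i.+1) || h (p i.+1) (p i)) ->
  exists b, antiwalk h b p n.
Proof.
move=> anti adj; have [->|n_gt0] := posnP n; first by exists false.
have noboth u v w : h u v -> h v w -> False.
  move=> uv vw; case: (anti v) => /eqP.
    by rewrite cards_eq0 => /eqP/setP/(_ u); rewrite !inE uv.
  by rewrite cards_eq0 => /eqP/setP/(_ w); rewrite !inE vw.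
exists (~~ h (p 0) (p 1)) => i; elim: i => [|i IHi] lt_in.
  by have := adj 0 lt_in; case: ifP => /=; case: (h (p 0) _).
have := IHi (ltnW lt_in); have /orP := adj _ lt_in.
rewrite /= addNb; case: (odd i (+) _) => /= [[]//|[]//] h1 h2.
  by case: (noboth _ _ _ h1 h2).
by case: (noboth _ _ _ h2 h1).
Qed.

Lemma antiwalk_map (W V : Type) (h : rel W) (e : rel V) (f : W -> V) b p n :
  (forall x y, h x y -> e (f x) (f y)) -> antiwalk h b p n ->
  antiwalk e b (f \o p) n.
Proof. by move=> he hw i /hw; case: ifP => _ /he. Qed.

Lemma antipath_antiwalk (V : finType) (e : rel V) (n : nat) :
  contains_antipath e n ->
  exists b g, antiwalk e b g n /\ {in [pred i | i <= n] &, injective g}.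
Proof.
case=> p [[_ adj] anti [f [f_inj fe]]].
have [i lt_in|b wb] := @antidirected_antiwalk _ p (fun i => inord i) n anti.
  by rewrite adj !inordK ?eqxx // ltnW.
exists b, (f \o fun i => inord i); split; first exact: antiwalk_map wb.
by move=> i j; rewrite !inE => le_in le_jn /f_inj/(congr1 val); rewrite /= !inordK.
Qed.

(** The walk winds around the cycle repeatedly; its length [m] is free, so that windows of [n]
    positions may start away from 0. *)
Lemma anticycle_antiwalk (V : finType) (e : rel V) (n m : nat) :
  contains_anticycle e n ->
  exists b g, [/\ antiwalk e b g m, forall i, g (i + n) = g i &
    {in [pred i | i < n] &, injective g}].
Proof.
case: n => [|n]; first by case=> p [[]].
case=> c [[n_gt2 _ adj] anti [f [f_inj fe]]].
pose p i : 'I_n.+1 := inord (i %% n.+1).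
have pS i : p i.+1 = ordS (p i).
  apply: val_inj; rewrite /= !inordK ?ltn_pmod //.
  by rewrite -addn1 -[in RHS]addn1 modnDml.
have [i _|b wb] := @antidirected_antiwalk _ c p m anti.
  by rewrite adj pS eqxx.
exists b, (f \o p); split; first exact: antiwalk_map wb.
  by move=> i; rewrite /= /p modnDr.
move=> i j; rewrite !inE => lt_in lt_jn /f_inj/(congr1 val).
by rewrite /= !inordK ?ltn_pmod // !modn_small.
Qed.

(** * Counting along a walk *)

Lemma leq_size_inj_in (T : finType) (r : seq nat) (h : nat -> T) :
  uniq r -> {in r &, injective h} -> size r <= #|T|.
Proof.
move=> r_uniq h_inj; rewrite -(size_map h).
by have /card_uniqP <- : uniq (map h r); [rewrite map_inj_in_uniq | exact: max_card].
Qed.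

Lemma leq_count_pairs (s : pred nat) (a n : nat) :
  (forall i, a <= i -> i.+1 < a + 2 * n -> s i || s i.+1) ->
  n <= count s (iota a (2 * n)).
Proof.
elim: n a => // n IHn a sa; rewrite mulnS iotaD count_cat /=.
have sa0 : s a || s a.+1 by apply: sa; lia.
have := IHn (a + 2) _; rewrite addn2 => IH.
by have := IH (fun i ai il => sa i ltac:(lia) ltac:(lia)); move: sa0; lia.
Qed.

(** * The construction for [k = m.+3] *)

Section Construction.
Variable m : nat.

(** The vertices [(b, inl _)] form [S_b] and the vertices [(b, inr _)] form [I_b]. *)
Definition extremal_vertex : finType := (bool * ('I_m.+3 + 'I_m.+2))%type.

Definition extremal_edge : rel extremal_vertex := fun u v =>
  match u, v with
  | (b, inl i), (c, inl j) => (c == b) && (j == ordS i)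
  | (b, inl _), (c, inr _) => c == ~~ b
  | (b, inr _), (c, inl _) => c == b
  | (_, inr _), (_, inr _) => false
  end.

Definition in_cycle (v : extremal_vertex) : bool := if v.2 is inl _ then true else false.

(* The index [b] of the copy [S_b] met by the edges leaving [v] (if [src]) or
   entering [v] (otherwise). *)
Definition block (src : bool) (v : extremal_vertex) : bool :=
  if in_cycle v then v.1 else src (+) ~~ v.1.

Lemma extremal_oriented : oriented_graph extremal_edge.
Proof.
have ordSx (i : 'I_m.+3) : (ordS i : nat) = if i == m.+2 :> nat then 0 else i.+1.
  rewrite /=; case: eqP => [->|/eqP ne]; first by rewrite modnn.
  by rewrite modn_small //; have := ltn_ord i; move: ne; lia.
have ordS_neq (i : 'I_m.+3) : (i == ordS i) = false.
  by apply/negP => /eqP/(congr1 (@nat_of_ord _)); rewrite ordSx; case: eqP; lia.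
split=> [[b [i|i]]|[b [i|i]] [c [j|j]] _] //=; rewrite ?ordS_neq ?andbF //.
(* A directed cycle of length at least 3 has no pair of opposite edges. *)
- apply/negP => /andP[/andP[_ /eqP->] /andP[_ /eqP/(congr1 (@nat_of_ord _))]].
  by rewrite !ordSx; do 2?[case: eqP]; lia.
- by case: b c => [] [].
by case: b c => [] [].
Qed.

Lemma sum_extremal (F : extremal_vertex -> nat) (b : bool) :
  \sum_v F v = \sum_i F (b, inl i) + \sum_i F (b, inr i) +
              (\sum_i F (~~ b, inl i) + \sum_i F (~~ b, inr i)).
Proof.
rewrite (eq_bigr (fun v => F (v.1, v.2))); last by case.
rewrite -(pair_bigA _ (fun c x => F (c, x))) big_bool /= !big_sumType.
by case: b => //=; rewrite addnC.
Qed.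

Lemma card_set_extremal (P : pred extremal_vertex) (b : bool) :
  #|[set v | P v]| =
    #|[pred i | P (b, inl i)]| + #|[pred i | P (b, inr i)]| +
    (#|[pred i | P (~~ b, inl i)]| + #|[pred i | P (~~ b, inr i)]|).
Proof.
by rewrite -sum1dep_card big_mkcond /= (sum_extremal _ b) -!big_mkcond !sum1_card.
Qed.

(** In each direction, a vertex of [S_b] has 1 neighbour on its cycle and [k - 1] in an independent
    set, while a vertex of [I_b] is joined to one whole cycle. *)
Lemma extremal_regular (v : extremal_vertex) :
  outdeg extremal_edge v = m.+3 /\ indeg extremal_edge v = m.+3.
Proof.
have cardF n : #|[pred _ : 'I_n | false]| = 0 by apply: eq_card0.
have cardI n : #|[pred _ : 'I_n | true]| = n by rewrite -[RHS]card_ord; apply: eq_card.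
rewrite /outdeg /indeg !(card_set_extremal _ v.1).
have succ1 (i : 'I_m.+3) : #|[pred j | j == ordS i]| = 1 by apply: eq_card1.
have pred1 (i : 'I_m.+3) : #|[pred j | i == ordS j]| = 1.
  apply: (@eq_card1 _ (ord_pred i)) => j.
  by rewrite !inE -[in LHS](ord_predK i) (inj_eq (@ordS_inj _)) eq_sym.
by case: v => [[] [i|i]] /=; rewrite ?cardF ?cardI ?succ1 ?pred1; split; lia.
Qed.

(** Every edge meets exactly one of [S_0] and [S_1], and both sides compute its index. *)
Lemma block_edge (u v : extremal_vertex) :
  extremal_edge u v -> block true u = block false v.
Proof.
by case: u v => b [i|i] [c [j|j]] //=; rewrite /block /=; case: b; case: c.
Qed.

Lemma independent_edge (u v : extremal_vertex) :
  extremal_edge u v -> in_cycle u || in_cycle v.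
Proof. by case: u v => b [i|i] [c [j|j]]. Qed.

(** * Antiwalks stay in one block *)

Section Antiwalk.
Variables (b : bool) (g : nat -> extremal_vertex) (n : nat).
Hypothesis walk_g : antiwalk extremal_edge b g n.

(** The boolean [~~ (odd i (+) b)] tells whether [g i] is a source, so [block_edge] carries the
    block from each vertex to the next. *)
Lemma antiwalk_block i : i <= n ->
  block (~~ (odd i (+) b)) (g i) = block (~~ b) (g 0).
Proof.
elim: i => // i IHi lt_in; rewrite -IHi ?(ltnW lt_in) //=.
by have := walk_g lt_in; rewrite addNb; case: (odd i (+) b) => /= /block_edge.
Qed.

Lemma antiwalk_in_cycle i : i < n -> in_cycle (g i) || in_cycle (g i.+1).
Proof. by move/walk_g; case: ifP => _ /independent_edge //; rewrite orbC. Qed.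

(** The cycle vertices visited share a block, so they lie in one [S_c] of size [k] and are told
    apart by their index there. *)
Lemma leq_count_in_cycle (r : seq nat) :
  uniq r -> {in r, forall i, i <= n} -> {in r &, injective g} ->
  count (in_cycle \o g) r <= m.+3.
Proof.
move=> r_uniq r_n g_inj; rewrite -size_filter -[m.+3]card_ord.
pose h i := if (g i).2 is inl x then x else ord0.
apply: (@leq_size_inj_in _ _ h); first exact: filter_uniq.
move=> i j; rewrite !mem_filter => /andP[/= ci ri] /andP[/= cj rj] hij.
apply: g_inj => //; have := antiwalk_block (r_n i ri).
rewrite -(antiwalk_block (r_n j rj)) /block ci cj; move: ci cj hij; rewrite /h.
by case: (g i) (g j) => [c [x|x]] [d [y|y]] //= _ _ -> ->.
Qed.

(** Positions of equal parity are all sources or all sinks; having the same block, these vertices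
    lie in one independent set, of size [k - 1]. *)
Lemma leq_size_independent (r : seq nat) (o : bool) :
  uniq r -> {in r, forall i, [/\ i <= n, odd i = o & ~~ in_cycle (g i)]} ->
  {in r &, injective g} -> size r <= m.+2.
Proof.
move=> r_uniq r_n g_inj; rewrite -[m.+2]card_ord.
pose h i := if (g i).2 is inr x then x else ord0.
apply: (@leq_size_inj_in _ _ h) => // i j ri rj hij; apply: g_inj => //.
have [le_in oi ci] := r_n i ri; have [le_jn oj cj] := r_n j rj.
have := antiwalk_block le_in; rewrite -(antiwalk_block le_jn) oi oj /block.
rewrite (negPf ci) (negPf cj) => /addbI/negb_inj; move: ci cj hij; rewrite /h.
by case: (g i) (g j) => [c [x|x]] [d [y|y]] //= _ _ -> ->.
Qed.

(** These are [k] positions of equal parity, one more than an independent set can hold; the bound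
    places the last one, [a + 2 * m.+2], within the walk. *)
Lemma leq_size_alternating (a : nat) :
  a + 2 * m.+3 <= n.+2 ->
  (forall j, j < m.+3 -> ~~ in_cycle (g (a + 2 * j))) ->
  ~ {in [seq a + 2 * j | j <- iota 0 m.+3] &, injective g}.
Proof.
move=> le_n indep /(@leq_size_independent _ (odd a)); rewrite size_map size_iota.
rewrite ltnn => absurd; apply: notF; apply: absurd.
  by rewrite map_inj_uniq ?iota_uniq // => i j; lia.
move=> _ /mapP[j jr ->]; rewrite mem_iota in jr; rewrite indep; last by lia.
by rewrite oddD mul2n odd_double addbF; split=> //; lia.
Qed.

End Antiwalk.

(** * Excluding antipaths and anticycles of length [2k] *)

Lemma extremal_no_antipath : ~ contains_antipath extremal_edge (2 * m.+3).
Proof.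
move=> /antipath_antiwalk[b [g [wg g_inj]]].
have gI (r : seq nat) : {in r, forall i, i <= 2 * m.+3} -> {in r &, injective g}.
  by move=> rn i j /rn ? /rn ?; apply: g_inj.
(* Were position [2j] on a cycle, the [j] pairs before it and the [k - j] pairs after it would each
   add a cycle vertex, making [k + 1]. *)
have indep j : j < m.+3 -> ~~ in_cycle (g (0 + 2 * j)).
  move=> lt_j; rewrite add0n; apply/negP => cj.
  have pairs a l : a + 2 * l <= (2 * m.+3).+1 -> l <= count (in_cycle \o g) (iota a (2 * l)).
    by move=> le_al; apply: leq_count_pairs => i _ ?; apply: (antiwalk_in_cycle wg); lia.
  have rn : {in iota 0 (2 * m.+3).+1, forall i, i <= 2 * m.+3}.
    by move=> i; rewrite mem_iota; lia.
  have := leq_count_in_cycle wg (iota_uniq _ _) rn (gI _ rn).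
  have -> : (2 * m.+3).+1 = 2 * j + (1 + 2 * (m.+3 - j)) by lia.
  rewrite iotaD iotaD !count_cat /= cj.
  have := pairs 0 j _; have := pairs (0 + 2 * j + 1) (m.+3 - j) _.
  move: (count _ _) (count _ _) => c1 c2 /(_ ltac:(lia)) ? /(_ ltac:(lia)) ?.
  by rewrite addn0 addnA addn1; lia.
apply: (leq_size_alternating wg _ indep); first by lia.
by apply: gI => _ /mapP[j jr ->]; rewrite mem_iota in jr; lia.
Qed.

Lemma extremal_no_anticycle : ~ contains_anticycle extremal_edge (2 * m.+3).
Proof.
(* Two turns, so that every window of [2k] positions starting in the first turn fits. *)
move=> /(anticycle_antiwalk (4 * m.+3))[b [g [wg g_per g_inj]]].
have winj a : a <= 2 * m.+3 -> {in iota a (2 * m.+3) &, injective g}.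
  move=> le_a i j; rewrite !mem_iota => ir jr.
  have red l : a <= l < a + 2 * m.+3 ->
      exists2 l', l' < 2 * m.+3 & g l = g l' /\ (l = l' \/ l = l' + 2 * m.+3).
    move=> lr; have [ll|ll] := ltnP l (2 * m.+3); first by exists l => //; split=> //; left.
    exists (l - 2 * m.+3); first by lia.
    by rewrite -(g_per (l - _)) subnK //; split=> //; right.
  have [i' li' [-> ei]] := red i ir; have [j' lj' [-> ej]] := red j jr.
  by move/(g_inj _ _ li' lj'); lia.
(* Two consecutive cycle vertices and the [k - 1] pairs completing the turn would again give [k + 1]
   cycle vertices. *)
have alt i : i < 2 * m.+3 -> in_cycle (g i) -> ~~ in_cycle (g i.+1).
  move=> lt_i ci; apply/negP => ci1.
  have rn : {in iota i (2 * m.+3), forall j, j <= 4 * m.+3}.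
    by move=> j; rewrite mem_iota; lia.
  have := leq_count_in_cycle wg (iota_uniq _ _) rn (winj i (ltnW lt_i)).
  have -> : 2 * m.+3 = 2 + 2 * m.+2 by lia.
  have : m.+2 <= count (in_cycle \o g) (iota (i + 2) (2 * m.+2)).
    by apply: leq_count_pairs => j _ ?; apply: (antiwalk_in_cycle wg); lia.
  by rewrite iotaD count_cat; move: (count _ _) => c; rewrite /= ci ci1; lia.
(* The first position outside the cycles is 0 or 1. *)
pose a : nat := in_cycle (g 0).
have indep j : j < m.+3 -> ~~ in_cycle (g (a + 2 * j)).
  elim: j => [|j IHj] lt_j.
    by rewrite muln0 addn0 /a; case c0: (in_cycle (g 0)); [apply: (alt 0)|rewrite /= c0].
  have := IHj (ltnW lt_j); have -> : a + 2 * j.+1 = (a + 2 * j).+2 by lia.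
  have /(antiwalk_in_cycle wg) : a + 2 * j < 4 * m.+3 by rewrite /a; lia.
  by move=> /orP[->//|c1] _; apply: alt c1; rewrite /a; lia.
apply: (leq_size_alternating wg (a := a)) => //; first by rewrite /a; lia.
have ain j : j \in [seq a + 2 * j | j <- iota 0 m.+3] -> j \in iota a (2 * m.+3).
  by case/mapP=> i; rewrite !mem_iota => ? ->; lia.
by move=> i j /ain ir /ain jr; apply: winj jr; rewrite // /a; lia.
Qed.

End Construction.

(** * Rotational tournaments for [k = 1] and [k = 2] *)

Definition tournament3 : rel 'I_3 := fun i j => j == ordS i.

Definition tournament5 : rel 'I_5 :=
  fun i j => (j == ordS i) || (j == ordS (ordS i)).

Lemma tournament3_oriented : oriented_graph tournament3.
Proof.
split=> [[[|[|[|?]]] ?]|] //.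
by move=> [[|[|[|?]]] ?] [[|[|[|?]]] ?] _.
Qed.

Lemma tournament5_oriented : oriented_graph tournament5.
Proof.
split=> [[[|[|[|[|[|?]]]]] ?]|] //.
by move=> [[|[|[|[|[|?]]]]] ?] [[|[|[|[|[|?]]]]] ?] _.
Qed.

Lemma tournament3_regular (v : 'I_3) :
  outdeg tournament3 v = 1 /\ indeg tournament3 v = 1.
Proof.
split; rewrite /outdeg /indeg -sum1dep_card big_mkcond !big_ord_recr big_ord0;
  by case: v => [[|[|[|?]]] ?].
Qed.

Lemma tournament5_regular (v : 'I_5) :
  outdeg tournament5 v = 2 /\ indeg tournament5 v = 2.
Proof.
split; rewrite /outdeg /indeg -sum1dep_card big_mkcond !big_ord_recr big_ord0;
  by case: v => [[|[|[|[|[|?]]]]] ?].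
Qed.

(** In- and out-neighbours are unique, so two alternating steps return to the start. *)
Lemma tournament3_no_antipath : ~ contains_antipath tournament3 2.
Proof.
move=> /antipath_antiwalk[b [g [wg g_inj]]].
suff /g_inj : g 0 = g 2 by rewrite !inE => /(_ isT isT).
have := wg 0 isT; have := wg 1 isT.
by case: {wg} b => /= /eqP e1 /eqP e0; [rewrite e0 | apply: ordS_inj; rewrite -e0].
Qed.

(** Distinctness makes the step sizes alternate between 1 and 2, and since [1 - 2 + 1 = 0] two of
    the five vertices coincide. The proof checks all cases. *)
Lemma tournament5_alternating (b : bool) (x0 x1 x2 x3 x4 : 'I_5) :
  let e x y := if b then tournament5 y x else tournament5 x y in
  [&& e x0 x1, e x2 x1, e x2 x3, e x4 x3 & uniq [:: x0; x1; x2; x3; x4]] = false.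
Proof.
case: b; case: x0 x1 => [[|[|[|[|[|?]]]]] ?] [[|[|[|[|[|?]]]]] ?] //.
all: case: x2 => [[|[|[|[|[|?]]]]] ?] //.
all: case: x3 => [[|[|[|[|[|?]]]]] ?] //.
all: by case: x4 => [[|[|[|[|[|?]]]]] ?].
Qed.

(** The out-neighbourhood of [x], namely [x + 1] and [x + 2] modulo 5, determines [x]. This rules
    out an anticycle of length 4, whose two sources share both sinks. *)
Lemma tournament5_common_outneighbours (x y z t : 'I_5) :
  [&& tournament5 x z, tournament5 x t, tournament5 y z, tournament5 y t, x != y
    & z != t] = false.
Proof.
case: x z => [[|[|[|[|[|?]]]]] ?] [[|[|[|[|[|?]]]]] ?] //.
all: case: t => [[|[|[|[|[|?]]]]] ?] //.
all: by case: y => [[|[|[|[|[|?]]]]] ?].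
Qed.

Lemma tournament5_no_antipath : ~ contains_antipath tournament5 4.
Proof.
move=> /antipath_antiwalk[b [g [wg g_inj]]].
have g_uniq : uniq [:: g 0; g 1; g 2; g 3; g 4].
  by rewrite (map_inj_in_uniq (s := iota 0 5)) // => i j; rewrite !mem_iota; apply: g_inj.
have := wg 3 isT; have := wg 2 isT; have := wg 1 isT; have := wg 0 isT.
have := tournament5_alternating b (g 0) (g 1) (g 2) (g 3) (g 4).
by case: {wg} b g_uniq => /= u H e0 e1 e2 e3; rewrite e0 e1 e2 e3 u in H.
Qed.

Lemma tournament5_no_anticycle : ~ contains_anticycle tournament5 4.
Proof.
move=> /(anticycle_antiwalk 4)[b [g [wg g_per g_inj]]].
have ne02 : g 0 != g 2 by apply/eqP => /g_inj; rewrite !inE => /(_ isT isT).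
have ne13 : g 1 != g 3 by apply/eqP => /g_inj; rewrite !inE => /(_ isT isT).
have := wg 3 isT; have := wg 2 isT; have := wg 1 isT; have := wg 0 isT.
(* Periodicity turns the fourth edge into the closing one; [b] decides which opposite pair is the
   sources. *)
rewrite /= (g_per 0); case: {wg} b => /= e0 e1 e2 e3.
  have := tournament5_common_outneighbours (g 1) (g 3) (g 0) (g 2).
  by rewrite e0 e1 e2 e3 ne02 ne13.
have := tournament5_common_outneighbours (g 0) (g 2) (g 1) (g 3).
by rewrite e0 e1 e2 e3 ne02 ne13.
Qed.

Theorem proposition1p4 (k : nat) (hk : 0 < k) :
  exists (V : finType) (e : rel V),
    [/\ oriented_graph e,
        min_semidegree e = k,
        min_pseudo_semidegree e = k,
        ~ contains_antipath e (2 * k)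
      & ~ contains_anticycle e (2 * k)].
Proof.
case: k hk => [|[|[|m]]] // _.
- exists 'I_3, tournament3; have [-> ->] :=
    regular_min_semidegrees (d := 1) ord0 isT tournament3_regular.
  split=> //; first exact: tournament3_oriented.
    exact: tournament3_no_antipath.
  (* An oriented cycle has length greater than 2. *)
  by case=> c [[]].
- exists 'I_5, tournament5; have [-> ->] :=
    regular_min_semidegrees (d := 2) ord0 isT tournament5_regular.
  split=> //; first exact: tournament5_oriented.
    exact: tournament5_no_antipath.
  exact: tournament5_no_anticycle.
exists (extremal_vertex m), (@extremal_edge m).
have [-> ->] :=
    regular_min_semidegrees (d := m.+3) (true, inl ord0) isT (@extremal_regular m).
split=> //; first exact: extremal_oriented.
  exact: extremal_no_antipath.
exact: extremal_no_anticycle.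
Qed.
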